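(* Let $\varepsilon>0$. There is a constant $C>0$ depending only on $\varepsilon$ such that for all real $Q,N\ge1$ and every sequence $(a_n)$ of complex numbers, $$T:=\sum_{q\le Q}\ \sum_{\substack{a=1\\ \gcd(a,q)=1}}^{q^2}\left|S\!\left(\frac{a}{q^2}\right)\right|^2\le C(\log 2Q)\,N^{\varepsilon}\left(Q^3+N+N^{1/2}Q^2\right)Z,$$ where $S(\alpha)=\sum_{n\le N}a_ne(n\alpha)$, $Z=\sum_{n\le N}|a_n|^2$, $e(x)=e^{2\pi i x}$, and $q$ runs over positive integers. *)

(* Defs.v *)
From mathcomp Require Import all_boot all_order all_algebra.
From mathcomp Require Export complex.
From mathcomp Require Import all_classical all_reals all_analysis.

Set Implicit Arguments.
Unset Strict Implicit.
Unset Printing Implicit Defensive.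

Import Order.TTheory GRing.Theory Num.Theory.
Import ComplexField.Normc.

Local Open Scope ring_scope.
Local Open Scope complex_scope.

Section LargeSieve.
Variable R : realType.

(* e^(2 i pi x), through Euler's formula: R[i] carries no exponential here. *)
Definition expc (x : R) : R[i] := cos (2 * pi * x) +i* sin (2 * pi * x).

(* For a real X >= 0, the naturals n <= Num.truncn X are exactly those with
   n%:R <= X, so the range 1 <= n < (Num.truncn X).+1 is 1 <= n <= X; [a 0] is
   never used below. *)
Definition expsum (N : R) (a : nat -> R[i]) (alpha : R) : R[i] :=
  \sum_(1 <= n < (Num.truncn N).+1) a n * expc (n%:R * alpha).

Definition coef_energy (N : R) (a : nat -> R[i]) : R :=
  \sum_(1 <= n < (Num.truncn N).+1) normc (a n) ^+ 2.

Definition square_sieve_sum (Q N : R) (a : nat -> R[i]) : R :=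
  \sum_(1 <= q < (Num.truncn Q).+1)
    \sum_(1 <= b < (q ^ 2).+1 | coprime b q)
      normc (expsum N a (b%:R / (q ^ 2)%:R)) ^+ 2.

End LargeSieve.

(* Main.v *)
Require Import Defs.
From mathcomp Require Import all_boot all_order all_algebra complex.
From mathcomp Require Import all_classical all_reals all_analysis.
From mathcomp Require Import zify ring lra.

(* Dividing the coefficients by the mean of e(nt) over 0 <= t < 1/(8N), which is
   at least 1/2 in modulus, writes S(x) as a mean over an interval of length 1/(8N)
   starting at x.  Cauchy-Schwarz and Parseval then bound T by O(K N Z), where K is
   the largest number of fractions a/q^2 in such an interval; all this is done with
   finite sums on a grid (1/M)Z that contains every a/q^2.

   If N < Q^2, then trivially K = O(Q^3/N).  If Q^2 <= N, each q occurs at most once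
   in the interval.  Let q1 be the largest, with fraction a1/q1^2: for any two others
   q' < q the number n = q^2 - q'^2 < q1^2 satisfies ||a1 n/q1^2|| = O(q1^2/N), which
   leaves O(Q^4/N + 1) values of n, and each n is (q - q')(q + q') in at most
   d(n) = O(N^eps) ways.  So K^2 = O(N^eps (Q^4/N + 1)). *)

Set Implicit Arguments.
Unset Strict Implicit.
Unset Printing Implicit Defensive.

Import Order.TTheory GRing.Theory Num.Theory.

(** * Clusters of fractions with square denominators *)

Lemma exists_max_fst (w : nat * nat) (W : seq (nat * nat)) :
  exists2 w1, w1 \in w :: W & forall v, v \in w :: W -> v.1 <= w1.1.
Proof.
elim: W => [|v W [w1 w1W maxw1]].
  by exists w; rewrite ?mem_head // => v; rewrite inE => /eqP ->.
have [lt_v|le_v] := leqP w1.1 v.1.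
  exists v => [|u]; first by rewrite !inE eqxx orbT.
  rewrite !inE orbCA => /orP[/eqP-> //|uW].
  by apply: leq_trans lt_v; apply: maxw1; rewrite inE.
exists w1 => [|u]; first by move: w1W; rewrite !inE orbCA => ->; rewrite orbT.
rewrite !inE orbCA => /orP[/eqP-> |uW]; first exact: ltnW.
by apply: maxw1; rewrite inE.
Qed.

(* [h * |b / q^2 - b' / q'^2| < 1] for all [(q, b)] and [(q', b')] in [W]. *)
Definition clustered (h : nat) (W : seq (nat * nat)) :=
  forall w w', w \in W -> w' \in W ->
    h * (w.2 * w'.1 ^ 2) < h * (w'.2 * w.1 ^ 2) + w.1 ^ 2 * w'.1 ^ 2.

(** For equal [q] the cluster condition reads h |b - b'| < q^2 <= h m, so the numerators differ by
    less than [m] and their residues decide. With [m = 1] this says that each [q] occurs at most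
    once. *)
Lemma clustered_modn_inj (h Q m : nat) (W : seq (nat * nat)) :
  clustered h W -> {in W, forall w, 0 < w.1 <= Q} -> Q ^ 2 <= h * m ->
  {in W &, injective (fun w => (w.1, w.2 %% m))}.
Proof.
move=> clW rW le_m [q b] [q' b'] wW w'W /= [/esym eq_q]; subst q'.
move: (clW _ _ wW w'W) (clW _ _ w'W wW) (rW _ wW) => /= H1 H2 /andP[q0 qQ].
have qq : q ^ 2 <= h * m by apply: leq_trans le_m; rewrite leq_exp2r.
have q20 : 0 < q ^ 2 by rewrite expn_gt0 q0.
move=> /eqP eq_b; congr pair; apply/eqP.
have h1 : h * b < h * (b' + m) by move: (q ^ 2) q20 qq H1; clear; nia.
have h2 : h * b' < h * (b + m) by move: (q ^ 2) q20 qq H2; clear; nia.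
have {h1 h2} [h1 h2] : b < b' + m /\ b' < b + m by split; nia.
have [le_bb|/ltnW le_bb] := leqP b b'.
  move: eq_b; rewrite eq_sym eqn_mod_dvd // => /dvdnP[[|k]]; rewrite ?mulSn; lia.
move: eq_b; rewrite eqn_mod_dvd // => /dvdnP[[|k]]; rewrite ?mulSn; lia.
Qed.

(** The trivial count: [Q] denominators, and for each of them as many numerators as there are
    residues modulo [m]. *)
Lemma size_clustered (h Q : nat) (W : seq (nat * nat)) :
  0 < h -> uniq W -> clustered h W -> {in W, forall w, 0 < w.1 <= Q} ->
  size W <= Q * (Q ^ 2 %/ h).+1.
Proof.
move=> h0 uW clW rW; set m := (_ %/ _).+1.
have m0 : 0 < m by [].
have le_m : Q ^ 2 <= h * m by rewrite mulnC ltnW // ltn_ceil.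
have inj := clustered_modn_inj clW rW le_m.
rewrite -(size_map (fun w => (w.1, w.2 %% m))).
rewrite -{1}(size_iota 1 Q) -{2}(size_iota 0 m) -(size_allpairs pair).
apply: uniq_leq_size; first by rewrite map_inj_in_uniq.
move=> _ /mapP[w wW ->]; apply/allpairsP; exists (w.1, w.2 %% m).
split => //; rewrite [fst _]/= ?[snd _]/=.
  by rewrite mem_iota add1n ltnS; exact: rW.
by rewrite mem_iota ltn_pmod.
Qed.

(** Swapping coordinates matches the pairs on the two sides of the diagonal, and the diagonal has
    [size s] elements. *)
Lemma size_upper_pairs (s : seq nat) : uniq s ->
  2 * size [seq p <- [seq (x, y) | x <- s, y <- s] | p.2 < p.1] =
  size s * (size s).-1.
Proof.
move=> us; set P := [seq _ | x <- s, y <- s].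
have uP : uniq P by apply: allpairs_uniq => // -[? ?] [? ?].
have sP : size P = size s * size s by rewrite size_allpairs.
have swap : perm_eq [seq (p.2, p.1) | p <- P] P.
  apply: uniq_perm => //; first by rewrite map_inj_uniq // => -[? ?] [? ?] [-> ->].
  move=> [x y]; apply/mapP/allpairsP => [[[u v] /allpairsP[[c d] /= [cs ds [-> ->]]] [-> ->]]|].
    by exists (d, c).
  by move=> [[c d] /= [cs ds [-> ->]]]; exists (d, c) => //; apply/allpairsP; exists (d, c).
have c1 : count (fun p => p.1 < p.2) P = count (fun p => p.2 < p.1) P.
  by rewrite -(permP swap) count_map.
have c2 : count (fun p => p.1 == p.2) P = size s.
  rewrite -size_filter -[RHS](size_map (fun x => (x, x))).
  apply/perm_size/uniq_perm; rewrite ?filter_uniq ?map_inj_uniq //; first by move=> ? ? [].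
  move=> [x y]; rewrite mem_filter /=; apply/andP/mapP => [[/eqP-> /allpairsP[[c d] /= [cs ds [-> ->]]]]|].
    by exists d.
  by move=> [z zs [-> ->]]; split => //; apply/allpairsP; exists (z, z).
rewrite size_filter mul2n -addnn -{1}c1.
have := count_predC (fun p => p.1 == p.2) P.
have -> : count (predC (fun p => p.1 == p.2)) P =
          count (fun p => p.1 < p.2) P + count (fun p => p.2 < p.1) P.
  by rewrite -size_filter -(count_predC (fun p : nat * nat => p.1 < p.2)) !count_filter;
     congr (_ + _); apply: eq_count => -[x y] /=; lia.
rewrite c2 sP; case: (size s) => [|n] /=; lia.
Qed.

Lemma sumn_size_le (T : eqType) (U : Type) (s : seq T) (t : T -> seq U) (D : nat) :
  {in s, forall x, size (t x) <= D} -> sumn [seq size (t x) | x <- s] <= D * size s.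
Proof.
elim: s => [|x s IH] ub /=; first by rewrite muln0.
rewrite mulnS leq_add ?ub ?mem_head // IH // => y ys.
by rewrite ub // inE ys orbT.
Qed.

(** Dividing x^2 - y^2 by x - y leaves x + y, and sum and difference recover the pair. A pair is
    thus coded by a number together with one of its divisors. *)
Lemma subn_sqr_pair_inj (p p' : nat * nat) :
  p.2 < p.1 -> p'.2 < p'.1 ->
  (p.1 ^ 2 - p.2 ^ 2, p.1 - p.2) = (p'.1 ^ 2 - p'.2 ^ 2, p'.1 - p'.2) -> p = p'.
Proof.
case: p p' => x y [x' y'] /= lt lt' [].
rewrite !subn_sqr => + eq_d; rewrite eq_d => /eqP.
by rewrite eqn_pmul2l ?subn_gt0 // => /eqP eq_s; congr pair; lia.
Qed.

(* Multiplying by [q1 ^ 2] the differences to [b1 / q1 ^ 2] and subtracting shows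
   that [b1 * n] is a small residue modulo [q1 ^ 2]; as [b1] is invertible and
   [n < q1 ^ 2], the residue determines [n]. *)
Lemma size_subn_sqr_clustered (h Q : nat) (W : seq (nat * nat)) (S : seq nat) (w1 : nat * nat) :
  0 < h -> clustered h W -> {in W, forall w, 0 < w.1 <= Q} ->
  w1 \in W -> {in W, forall w, w.1 <= w1.1} -> coprime w1.2 w1.1 -> uniq S ->
  (forall n, n \in S -> exists w w', [/\ w \in W, w' \in W, w'.1 < w.1 & n = w.1 ^ 2 - w'.1 ^ 2]) ->
  size S <= (2 * (2 * Q ^ 4 %/ h)).+1.
Proof.
move=> h0 clW rW w1W maxw1 cop1 uS defS; set E := _ %/ h.
have m0 : 0 < w1.1 ^ 2 by rewrite expn_gt0; case/andP: (rW _ w1W) => ->.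
(* The shift by [E] carries residues of absolute value at most [E] to 0, ..., 2E, whence the 2E + 1
   of the bound. *)
have inj : {in S &, injective (fun n => (w1.2 * n + E) %% w1.1 ^ 2)}.
  have ltS n : n \in S -> n < w1.1 ^ 2.
    move=> /defS [w [w' [wW w'W lt ->]]].
    have w20 : 0 < w'.1 ^ 2 by rewrite expn_gt0; case/andP: (rW _ w'W) => ->.
    have : w.1 ^ 2 <= w1.1 ^ 2 by rewrite leq_exp2r // maxw1.
    by move: w20 m0; clear; lia.
  have half n n' : n \in S -> n' \in S -> n <= n' ->
      (w1.2 * n + E) %% w1.1 ^ 2 = (w1.2 * n' + E) %% w1.1 ^ 2 -> n = n'.
    move=> nS n'S le /eqP; rewrite eqn_modDr eq_sym eqn_mod_dvd ?leq_mul2l ?le ?orbT //.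
    rewrite -mulnBr Gauss_dvdr; last by rewrite coprime_sym coprimeXr.
    have := ltS _ n'S; case: (posnP (n' - n)) => [|d0 lt /(dvdn_leq d0)]; lia.
  move=> n n' nS n'S eq_r; have [/half|/ltnW/half] := leqP n n'; first exact.
  by move=> ->.
rewrite -(size_map (fun n => (w1.2 * n + E) %% w1.1 ^ 2)) -[leqRHS](size_iota 0).
apply: uniq_leq_size; first by rewrite map_inj_in_uniq.
move=> _ /mapP[n nS ->]; rewrite mem_iota /= add0n ltnS.
have [w [w' [wW w'W lt ->]]] := defS _ nS.
have lt_sq : w'.1 ^ 2 <= w.1 ^ 2 by rewrite leq_exp2r // ltnW.
have bd v : v \in W -> v.1 ^ 2 * w1.1 ^ 2 <= Q ^ 4.
  move=> vW; rewrite -[4]/(2 + 2) expnD leq_mul // leq_exp2r //.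
    by case/andP: (rW _ vW).
  by case/andP: (rW _ w1W).
have := bd _ wW; have := bd _ w'W.
have := clW _ _ wW w1W; have := clW _ _ w1W wW.
have := clW _ _ w'W w1W; have := clW _ _ w1W w'W.
have := ltn_ceil (2 * Q ^ 4) h0; rewrite -/E.
move: (Q ^ 4) (w.1 ^ 2) (w'.1 ^ 2) (w1.1 ^ 2) w1.2 w.2 w'.2 lt_sq => q4 s s' s1 b1 b b'.
move=> le_s HE H1 H2 H3 H4 H5 H6.
have eX : h * (b1 * s) = h * (b1 * (s - s')) + h * (b1 * s').
  by rewrite -!mulnDr subnK.
(* Both b1 s - b s1 and b1 s' - b' s1 are below Q^4/h in absolute value. Their difference is an
   integer below 2Q^4/h, hence at most [E], in absolute value. *)
have [lo hi] : b * s1 <= b1 * (s - s') + E + b' * s1 /\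
               b1 * (s - s') + E + b' * s1 <= b * s1 + 2 * E.
  rewrite (mulSn E) (mulnC E) in HE; rewrite (mulnC s1) in H1; rewrite (mulnC s1) in H3.
  split; rewrite -ltnS -(ltn_pmul2l h0) !mulnS !mulnDr ?(mulnCA h 2);
  move: (h * E) (h * (b * s1)) (h * (b' * s1)) (h * (b1 * s)) (h * (b1 * s'))
        (h * (b1 * (s - s'))) (s * s1) (s' * s1) HE H1 H2 H3 H4 H5 H6 eX; clear; lia.
have -> : (b1 * (s - s') + E) %% s1 = (b1 * (s - s') + E + b' * s1 - b * s1) %% s1.
  by rewrite -(modnMDl b (_ - _)) subnKC // [in RHS]addnC modnMDl.
by apply: leq_trans (leq_mod _ _) _; rewrite leq_subLR.
Qed.

(** The denominators are distinct, so half of the left side counts the pairs q' < q. Each pair is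
    coded by n = q^2 - q'^2 and the divisor q - q' of n: at most [D] pairs for each n, and few
    values of n by the preceding lemma. *)
Lemma size_clustered_coprime (h Q D : nat) (W : seq (nat * nat)) :
  0 < h -> Q ^ 2 <= h -> uniq W -> clustered h W ->
  {in W, forall w, 0 < w.1 <= Q} -> {in W, forall w, coprime w.2 w.1} ->
  (forall n, 0 < n <= Q ^ 2 -> size (divisors n) <= D) ->
  size W * (size W).-1 <= 2 * (D * (2 * (2 * Q ^ 4 %/ h)).+1).
Proof.
move=> h0 leQ uW clW rW cW ubD.
have injW : {in W &, injective fst}.
  move=> w w' wW w'W eq1; apply: (clustered_modn_inj (m := 1) clW rW) => //.
    by rewrite muln1.
  by rewrite !modn1 eq1.
case: W uW clW rW cW injW => [|w0 W0]; first by rewrite mul0n.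
have [w1 w1W maxw1] := exists_max_fst w0 W0.
move: (w0 :: W0) w1W maxw1 => {w0 W0} W w1W maxw1 uW clW rW cW injW.
have uA : uniq (map fst W) by rewrite map_inj_in_uniq.
rewrite -(size_map fst W) -size_upper_pairs // leq_mul2l /=.
set P := seq.filter _ _.
have PP p : p \in P -> exists w w', [/\ w \in W, w' \in W, w'.1 < w.1 & p = (w.1, w'.1)].
  rewrite mem_filter => /andP[lt /allpairsP[[x y] /= [/mapP[w wW ex] /mapP[w' w'W ey] ep]]].
  by exists w, w'; rewrite ep ex ey; split => //; move: lt; rewrite ep ex ey.
pose g (p : nat * nat) := p.1 ^ 2 - p.2 ^ 2.
pose S := undup (map g P).
have PS n : n \in S -> exists w w', [/\ w \in W, w' \in W, w'.1 < w.1 & n = w.1 ^ 2 - w'.1 ^ 2].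
  rewrite mem_undup => /mapP[p /PP[w [w' [wW w'W lt ->]]] ->].
  by exists w, w'.
have Spos n : n \in S -> 0 < n <= Q ^ 2.
  move=> /PS[w [w' [wW w'W lt ->]]]; rewrite subn_gt0 ltn_exp2r // lt.
  by rewrite (leq_trans (leq_subr _ _)) // leq_exp2r //; case/andP: (rW _ wW).
apply: leq_trans (_ : size [seq (n, d) | n <- S, d <- divisors n] <= _); last first.
  rewrite size_allpairs_dep; apply: leq_trans (sumn_size_le (D := D) _) _.
    by move=> n nS; apply/ubD/Spos.
  rewrite leq_mul2l; apply/orP; right.
  by apply: (size_subn_sqr_clustered h0 clW rW w1W maxw1 (cW _ w1W) (undup_uniq _)).
rewrite -(size_map (fun p : nat * nat => (p.1 ^ 2 - p.2 ^ 2, p.1 - p.2)) P).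
apply: uniq_leq_size.
  rewrite map_inj_in_uniq ?filter_uniq ?allpairs_uniq //; first by move=> [? ?] [? ?].
  move=> p p'; rewrite !mem_filter => /andP[lt _] /andP[lt' _].
  exact: subn_sqr_pair_inj.
move=> _ /mapP[p pP ->]; apply/allpairsPdep; exists (g p), (p.1 - p.2).
have gS : g p \in S by rewrite mem_undup map_f.
split => //; rewrite -dvdn_divisors; last by case/andP: (Spos _ gS).
by rewrite /g subn_sqr dvdn_mulr.
Qed.

(** * The divisor bound d(n) = O(n^eps) *)

(** A divisor is determined by its exponent at [p] and its part prime to [p]. *)
Lemma size_divisors_part (p n : nat) : (0 < n)%N -> prime p ->
  (size (divisors n) <= (logn p n).+1 * size (divisors n`_p^'))%N.
Proof.
move=> n0 pp.
have m0 : (0 < n`_p^')%N by rewrite part_gt0.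
rewrite -(size_map (fun d => (logn p d, d`_p^'))) -(size_iota 0 (logn p n).+1).
rewrite -(size_allpairs pair); apply: uniq_leq_size.
  rewrite map_inj_in_uniq ?divisors_uniq // => d d'.
  rewrite -!dvdn_divisors // => dn d'n [eq1 eq2].
  have d0 := dvdn_gt0 n0 dn; have d'0 := dvdn_gt0 n0 d'n.
  by rewrite -(partnC p d0) -(partnC p d'0) !p_part eq1 eq2.
move=> _ /mapP[d dn ->]; rewrite -dvdn_divisors // in dn.
apply/allpairsP; exists (logn p d, d`_p^'); split => //.
  by rewrite mem_iota /= add0n ltnS dvdn_leq_log.
by rewrite -dvdn_divisors // partn_dvd.
Qed.

Local Open Scope ring_scope.

Section DivisorBound.
Variables (R : realType) (eps : R).
Hypothesis eps_gt0 : 0 < eps.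

Lemma natr_powR_part (p n : nat) : (0 < n)%N -> prime p ->
  n%:R `^ eps = (p%:R `^ eps) ^+ logn p n * (n`_p^')%N%:R `^ eps :> R.
Proof.
move=> n0 pp; rewrite -{1}(partnC p n0) natrM powRM // p_part natrX.
by congr (_ * _); rewrite -powR_mulrn ?ler0n // powRAC powR_mulrn ?powR_ge0.
Qed.

(** Induction step of the divisor bound: splitting off the prime [p] costs a factor [c]. *)
Lemma le_divisors_part (p n : nat) (c K : R) : (0 < n)%N -> prime p ->
  (forall k : nat, k.+1%:R <= c * (p%:R `^ eps) ^+ k) ->
  (size (divisors (n`_p^')%N))%:R <= K * (n`_p^')%N%:R `^ eps ->
  (size (divisors n))%:R <= c * K * n%:R `^ eps.
Proof.
move=> n0 pp Hc HK.
apply: le_trans (_ : (logn p n).+1%:R * (size (divisors (n`_p^')%N))%:R <= _).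
  by rewrite -natrM ler_nat size_divisors_part.
by rewrite (natr_powR_part n0 pp) mulrACA ler_pM.
Qed.

Lemma bernoulli_expr (x y : R) (k : nat) : 0 <= x -> 1 + x <= y -> 1 + k%:R * x <= y ^+ k.
Proof.
move=> x0 xy; elim: k => [|k IH]; first by rewrite mul0r addr0 expr0.
rewrite exprS; apply: le_trans (_ : (1 + x) * (1 + k%:R * x) <= _).
  by rewrite -natr1; have : 0 <= k%:R :> R by []; nra.
apply: ler_pM => //; first by rewrite addr_ge0.
by rewrite addr_ge0 // mulr_ge0.
Qed.

(* Primes [p] with [p `^ eps >= 2] contribute no constant; each of the finitely
   many smaller primes contributes at most one factor [c]. *)
Lemma divisor_bound : exists2 C : R, 1 <= C &
  forall n : nat, (0 < n)%N -> (size (divisors n))%:R <= C * n%:R `^ eps.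
Proof.
(* Chosen so that c (1 + k x) = k + 1 + (k x + 1/x) exceeds k + 1; Bernoulli bounds (p^eps)^k below
   by 1 + k x. *)
pose x : R := 2 `^ eps - 1; pose c := 1 + x^-1.
have x0 : 0 < x.
  rewrite subr_gt0; have := @gt0_ltr_powR R eps eps_gt0 1 2.
  by rewrite !nnegrE powR1 ltr1n; exact.
have c1 : 1 <= c by rewrite lerDl invr_ge0 ltW.
have le_c (p k : nat) : prime p -> k.+1%:R <= c * (p%:R `^ eps) ^+ k.
  move=> pp; apply: le_trans (_ : c * (1 + k%:R * x) <= _).
    have -> : c * (1 + k%:R * x) = k.+1%:R + (k%:R * x + x^-1).
      by rewrite /c -nat1r; field; rewrite gt_eqF.
    by rewrite lerDl addr_ge0 ?mulr_ge0 ?invr_ge0 // ltW.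
  rewrite ler_pM2l ?(lt_le_trans ltr01) // bernoulli_expr ?(ltW x0) //.
  by rewrite /x addrC subrK ge0_ler_powR ?nnegrE ?(ltW eps_gt0) // ler_nat prime_gt1.
(* For p >= B one has p^eps >= 2, and 2^k >= k + 1 gives the constant 1. *)
pose B := (Num.truncn (2 `^ eps^-1 : R)).+1.
have le_big (p k : nat) : (B <= p)%N -> k.+1%:R <= 1 * (p%:R `^ eps) ^+ k.
  move=> Bp; rewrite mul1r -nat1r -[k%:R]mulr1 bernoulli_expr //.
  have -> : 1 + 1 = (2 `^ eps^-1) `^ eps :> R.
    by rewrite -powRrM mulVf ?gt_eqF // powRr1.
  rewrite ge0_ler_powR ?nnegrE ?powR_ge0 ?(ltW eps_gt0) //.
  by apply: le_trans (ltW (truncnS_gt _)) _; rewrite ler_nat.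
have primes_part p n q : (0 < n)%N -> prime p -> q \in primes (n`_p^')%N -> q != p /\ q \in primes n.
  move=> n0 pp; rewrite !mem_primes part_gt0 n0 /= => /andP[pq qd].
  split; last by rewrite pq (dvdn_trans qd) ?dvdn_part.
  by have := part_pnat p^' n; move/pnatP => /(_ (part_gt0 _ _) q pq qd).
(* Induction on [i], all primes of [n] being at least B - i. The step removes the prime B - (i + 1),
   if present, at cost [c]; for [i = 0] strong induction on [n] removes its smallest prime at no
   cost. At [i = B] the condition is void. *)
have key i n : (0 < n)%N -> (forall q, q \in primes n -> (B <= q + i)%N) ->
    (size (divisors n))%:R <= c ^+ i * n%:R `^ eps.
  elim: i n => [|i IH] n.
    elim/ltn_ind: n => n IH n0 Hn.
    have [n1|n1] := leqP n 1.
      have -> : n = 1%N by apply/eqP; rewrite eqn_leq n1.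
      by rewrite expr0 mul1r powR1.
    have pp := pdiv_prime n1.
    have pn : pdiv n \in primes n by rewrite mem_primes pp n0 pdiv_dvd.
    have -> : c ^+ 0 = 1 * c ^+ 0 by rewrite mul1r.
    apply: (le_divisors_part n0 pp).
      by move=> k; apply: le_big; have := Hn _ pn; rewrite addn0.
    apply: IH; rewrite ?part_gt0 //.
      rewrite -[ltnRHS](partnC (pdiv n) n0) p_part ltn_Pmull ?part_gt0 //.
      by rewrite -(expn0 (pdiv n)) ltn_exp2l ?prime_gt1 // logn_gt0.
    by move=> q /(primes_part _ _ _ n0 pp)[_ /Hn].
  move=> n0 Hn.
  case: (altP (@hasP _ (fun q => q + i.+1 == B)%N (primes n))) => [[p pn /eqP pB]|/hasPn none].
    have pp : prime p by move: pn; rewrite mem_primes => /andP[].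
    rewrite exprS; apply: (le_divisors_part n0 pp) => [k|]; first exact: le_c.
    apply: IH; first by rewrite part_gt0.
    by move=> q /(primes_part _ _ _ n0 pp)[qp /Hn]; lia.
  apply: le_trans (IH n n0 _) _; first by move=> q qn; have := Hn q qn; have := none q qn; lia.
  by rewrite exprS ler_wpM2r ?powR_ge0 // ler_peMl ?exprn_ge0 // (le_trans ler01).
exists (c ^+ B); first by rewrite exprn_ege1.
by move=> n n0; apply: key => // q _; rewrite leq_addl.
Qed.

End DivisorBound.


(** * Exponential sums, Cauchy-Schwarz and Parseval on a finite grid *)

Section GridSieve.
Import ComplexField.Normc.
Local Open Scope complex_scope.
Variable R : realType.
Implicit Types (x y : R) (a b : nat -> R[i]).

Lemma expcD x y : expc (x + y) = expc x * expc y.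
Proof.
rewrite /expc mulrDr cosD sinD; apply/eqP; rewrite eq_complex /=.
by rewrite eqxx addrC eqxx.
Qed.

Lemma expc0 : expc (0 : R) = 1.
Proof. by rewrite /expc mulr0 cos0 sin0. Qed.

Lemma expc_natM x (k : nat) : expc (k%:R * x) = expc x ^+ k.
Proof.
elim: k => [|k IH]; first by rewrite mul0r expc0.
by rewrite -nat1r mulrDl mul1r expcD IH exprS.
Qed.

Lemma expc_nat (k : nat) : expc (k%:R : R) = 1.
Proof.
rewrite -[k%:R]mulr1 expc_natM /expc mulr1 mulr_natl cos2pi sin2pi.
exact: expr1n.
Qed.

Lemma normc_ge0 (z : R[i]) : 0 <= normc z.
Proof. by case: z => u v; exact: sqrtr_ge0. Qed.

Lemma normc_expc x : normc (expc x) = 1.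
Proof. by rewrite /normc /expc cos2Dsin2 sqrtr1. Qed.

Lemma expc_neq0 x : expc x != 0.
Proof.
by apply/eqP => x0; have := normc_expc x; rewrite x0 normc0 => /esym/eqP; rewrite oner_eq0.
Qed.

Lemma expc_neq1 x : 0 < x < 1 -> expc x != 1.
Proof.
move=> /andP[x0 x1]; rewrite /expc eq_complex /= negb_and; apply/orP; left.
have -> : 2 * pi * x = (pi * x) *+ 2 by rewrite -mulrA mulr_natl.
have s0 : 0 < sin (pi * x).
  by rewrite sin_gt0_pi // mulr_gt0 ?pi_gt0 //= gtr_pMr ?pi_gt0.
rewrite cos_mulr2n cos2sin2 lt_eqF //.
by have := exprn_gt0 2 s0; lra.
Qed.

Lemma expc_inj x y : 0 <= x < 1 -> 0 <= y < 1 -> expc x = expc y -> x = y.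
Proof.
wlog lt_xy : x y / x < y.
  move=> IH x01 y01 e; have [/IH->//|/IH yx|//] := ltgtP x y.
  exact/esym/yx.
move=> x01 y01 e; have : expc (y - x) != 1 by apply: expc_neq1; lra.
by case/eqP; apply: (mulfI (expc_neq0 x)); rewrite -expcD addrC subrK e mulr1.
Qed.

Lemma le_sum_normc (I : Type) (r : seq I) (F : I -> R[i]) :
  normc (\sum_(i <- r) F i) <= \sum_(i <- r) normc (F i).
Proof.
elim/big_ind2 : _ => //; first by rewrite normc0.
by move=> x u y v xu yv; apply: le_trans (le_normcD _ _) (lerD xu yv).
Qed.

Lemma sqr_normcE (z : R[i]) : (normc z ^+ 2)%:C = z * z^*%C.
Proof. by rewrite -sqr_normc -rmorphXn. Qed.

Lemma normc_real x : 0 <= x -> normc x%:C = x.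
Proof. by move=> x0; rewrite /normc /= expr0n /= addr0 sqrtr_sqr ger0_norm. Qed.

(** Cauchy-Schwarz against the constant 1, from expanding the nonnegative sum of squared deviations
    from the mean. *)
Lemma sqr_sum_le (m : nat) (r : nat -> R) :
  (\sum_(j < m) r j) ^+ 2 <= m%:R * \sum_(j < m) r j ^+ 2.
Proof.
case: m => [|m]; first by rewrite !big_ord0 expr0n mul0r.
set s := \sum_(j < m.+1) r j; set n := m.+1%:R.
have n0 : 0 < n by rewrite ltr0n.
have : 0 <= \sum_(j < m.+1) (r j - s / n) ^+ 2 by apply: sumr_ge0 => j _; exact: sqr_ge0.
have -> : \sum_(j < m.+1) (r j - s / n) ^+ 2 = \sum_(j < m.+1) r j ^+ 2 - s ^+ 2 / n.
  under eq_bigr => j _ do rewrite sqrrB.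
  rewrite !big_split /= sumrN sumrMnl -mulr_suml -/s sumr_const card_ord -mulr_natl -/n.
  by field; rewrite gt_eqF.
by rewrite subr_ge0 ler_pdivrMr // mulrC.
Qed.

(** Orthogonality: for n <> n' the ratio of [w n] and [w n'] is an [m]-th root of unity other than
    1, so its geometric sum vanishes and only the diagonal survives. *)
Lemma parseval (m : nat) (s : seq nat) (w b : nat -> R[i]) :
  uniq s -> {in s, forall n, normc (w n) = 1} -> {in s, forall n, w n ^+ m = 1} ->
  {in s &, injective w} ->
  \sum_(t < m) normc (\sum_(n <- s) b n * w n ^+ t) ^+ 2 =
  m%:R * \sum_(n <- s) normc (b n) ^+ 2.
Proof.
move=> us nw wm injw; apply: complexI.
rewrite rmorphM !rmorph_sum /= rmorph_nat mulr_sumr.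
under eq_bigr => t _ do rewrite sqr_normcE rmorph_sum mulr_suml.
rewrite exchange_big /=; apply: eq_big_seq => n ns.
under eq_bigr => t _ do rewrite mulr_sumr.
have geom n' : \sum_(t < m) b n * w n ^+ t * (b n' * w n' ^+ t)^*%C =
    b n * (b n')^*%C * \sum_(t < m) (w n * (w n')^*%C) ^+ t.
  rewrite mulr_sumr; apply: eq_bigr => t _.
  by rewrite rmorphM rmorphXn mulrACA -exprMn.
have w1 n' : n' \in s -> w n' * (w n')^*%C = 1.
  by move=> n's; rewrite -sqr_normcE nw // expr1n.
rewrite exchange_big /= (bigD1_seq n) //= [X in _ + X]big1_seq ?addr0.
  rewrite geom w1 // -sqr_normcE mulrC; congr (_ * _).
  by under eq_bigr => t _ do rewrite expr1n; rewrite sumr_const card_ord.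
move=> n' /andP[neq n's]; rewrite geom.
have z1 : w n * (w n')^*%C - 1 != 0.
  rewrite subr_eq0; apply: contra neq => /eqP z1; apply/eqP/injw => //.
  by rewrite -[RHS]mulr1 -(w1 n') // mulrCA z1 mulr1.
have /eqP := subrX1 (w n * (w n')^*%C) m.
rewrite exprMn -rmorphXn !wm // rmorph1 mulr1 subrr eq_sym mulf_eq0 (negPf z1) /=.
by move=> /eqP ->; rewrite mulr0.
Qed.

(** Here 2 cos^2 x - 1 = cos 2x >= 0, which excludes 0 <= cos x < 1/2. *)
Lemma cos_ge_half x : 0 <= x <= pi / 4 -> 1 / 2 <= cos x.
Proof.
move=> /andP[x0 x1].
have p0 := pi_ge0 R.
have : 0 <= cos (x *+ 2) by apply: cos_ge0_pihalf; rewrite [x *+ 2]mulr2n; apply/andP; split; lra.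
have : 0 <= cos x by apply: cos_ge0_pihalf; apply/andP; split; lra.
rewrite cos_mulr2n [_ *+ 2]mulr2n expr2 => c0 c1; rewrite leNgt; apply/negP => lt.
have : 0 <= cos x * (1 / 2 - cos x) by rewrite mulr_ge0 // subr_ge0 ltW.
by rewrite mulrBr; lra.
Qed.

(** * Smoothing over windows of length 1/(8N) and the large sieve on the grid *)

Section Demean.
Variables (N L : nat).
Hypotheses (N_gt0 : (0 < N)%N) (L_gt0 : (0 < L)%N).

(** The grid has step 1/M, so [L] steps have length 1/(8N). *)
Let M : R := (8 * N * L)%:R.

Let M_gt0 : 0 < M.
Proof. by rewrite ltr0n !muln_gt0 N_gt0 L_gt0. Qed.

Definition mean_expc (n : nat) : R[i] := (L%:R)^-1 * \sum_(j < L) expc (n%:R * (j%:R / M)).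

Definition demean a (n : nat) : R[i] := a n / mean_expc n.

(** For j < L and n <= N the angle 2 pi n j / M is at most pi/4, so every term has real part at
    least 1/2. *)
Lemma normc_mean_expc (n : nat) : (n <= N)%N -> 1 / 2 <= normc (mean_expc n).
Proof.
move=> nN; have L0 : 0 < L%:R :> R by rewrite ltr0n.
have -> : mean_expc n = ((L%:R)^-1)%:C * \sum_(j < L) expc (n%:R * (j%:R / M)).
  by rewrite rmorphV ?unitfE ?gt_eqF // rmorph_nat.
have -> : 1 / 2 = L%:R^-1 * (L%:R * (1 / 2)) :> R by field; rewrite gt_eqF.
rewrite normcM normc_real ?invr_ge0 ?(ltW L0) // ler_pM2l ?invr_gt0 //.
apply: le_trans (_ : complex.Re (\sum_(j < L) expc (n%:R * (j%:R / M))) <= _).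
  rewrite raddf_sum /= mulr_natl -{1}(card_ord L) -sumr_const ler_sum // => j _.
  apply: cos_ge_half; rewrite !mulr_ge0 ?invr_ge0 ?pi_ge0 ?(ltW M_gt0) //=.
  have : n%:R * j%:R <= N%:R * L%:R :> R by rewrite ler_pM // ler_nat // ltnW.
  have -> : 2 * pi * (n%:R * (j%:R / M)) = (n%:R * j%:R) / (N%:R * L%:R) * (pi / 4).
    by rewrite /M !natrM; field; rewrite !pnatr_eq0 -!lt0n N_gt0 L_gt0.
  move=> le; rewrite ler_piMl ?divr_ge0 ?pi_ge0 // ler_pdivrMr ?mul1r //.
  by rewrite mulr_gt0 ?ltr0n.
by have := normc_ge_Re (\sum_(j < L) expc (n%:R * (j%:R / M))); rewrite lecR; apply: le_trans; exact: ler_norm.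
Qed.

Lemma mean_expc_neq0 (n : nat) : (n <= N)%N -> mean_expc n != 0.
Proof. by move=> /normc_mean_expc le; apply/eqP => m0; move: le; rewrite m0 normc0; lra. Qed.

(** Averaging over the translates multiplies the coefficient of index [n] by [mean_expc n], which
    [demean] has divided out. *)
Lemma sum_demean a x :
  \sum_(1 <= n < N.+1) a n * expc (n%:R * x) =
  (L%:R)^-1 * \sum_(j < L) \sum_(1 <= n < N.+1) demean a n * expc (n%:R * (x + j%:R / M)).
Proof.
rewrite exchange_big /= mulr_sumr; apply: eq_big_nat => n /andP[_ nN].
under eq_bigr => j _ do rewrite mulrDr expcD mulrA.
by rewrite -mulr_sumr mulrCA -/(mean_expc n) mulrAC divfK // mean_expc_neq0.
Qed.

Lemma sqr_normc_demean a (n : nat) : (n <= N)%N ->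
  normc (demean a n) ^+ 2 <= 4 * normc (a n) ^+ 2.
Proof.
move=> nN; have m2 := normc_mean_expc nN.
have m0 : 0 < normc (mean_expc n) by apply: lt_le_trans m2; rewrite divr_gt0.
rewrite /demean normcM normcV exprMn mulrC ler_wpM2r ?sqr_ge0 //.
rewrite exprVn invf_ple ?posrE ?exprn_gt0 //.
have -> : 4^-1 = (1 / 2) ^+ 2 :> R by field.
by rewrite ler_pXn2r ?nnegrE ?(ltW m0) ?divr_ge0.
Qed.

(** The sum runs over two periods of the grid, so that a window starting at most at [M] stays in
    range without wrapping around. *)
Lemma parseval_grid b :
  \sum_(t < 2 * (8 * N * L)) normc (\sum_(1 <= n < N.+1) b n * expc (n%:R * (t%:R / M))) ^+ 2 =
  2 * M * \sum_(1 <= n < N.+1) normc (b n) ^+ 2.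
Proof.
have -> : 2 * M = (2 * (8 * N * L))%:R by rewrite natrM.
rewrite -(parseval (w := fun n => expc (n%:R / M))) ?iota_uniq //.
- by apply: eq_bigr => t _; congr (normc _ ^+ 2); apply: eq_bigr => n _; rewrite -expc_natM mulrCA.
- by move=> n _; exact: normc_expc.
- move=> n _; rewrite -expc_natM natrM -/M mulrCA mulfK ?gt_eqF //.
  by rewrite -natrM expc_nat.
have in01 n : n \in index_iota 1 N.+1 -> 0 <= n%:R / M < 1.
  rewrite mem_index_iota => /andP[_ nN].
  rewrite divr_ge0 ?ler0n ?(ltW M_gt0) //= ltr_pdivrMr // mul1r ltr_nat.
  by move: N_gt0 L_gt0 nN; clear; nia.
move=> n n' ns n's /(expc_inj (in01 _ ns) (in01 _ n's)) /(mulIf _).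
by rewrite invr_eq0 gt_eqF // => /(_ isT) /eqP; rewrite eqr_nat => /eqP.
Qed.

Lemma sqr_normc_sum_demean a (c : nat) :
  normc (\sum_(1 <= n < N.+1) a n * expc (n%:R * (c%:R / M))) ^+ 2 <=
  L%:R^-1 * \sum_(j < L) normc (\sum_(1 <= n < N.+1) demean a n *
                                expc (n%:R * ((c + j)%:R / M))) ^+ 2.
Proof.
have L0 : 0 < L%:R :> R by rewrite ltr0n.
have -> : L%:R^-1 = L%:R^-1 ^+ 2 * L%:R :> R by field; rewrite gt_eqF.
pose f j := normc (\sum_(1 <= n < N.+1) demean a n * expc (n%:R * ((c + j)%:R / M))).
rewrite -mulrA; apply: le_trans (ler_wpM2l (sqr_ge0 _) (sqr_sum_le L f)).
rewrite -exprMn ler_pXn2r ?nnegrE ?mulr_ge0 ?invr_ge0 ?sumr_ge0 //; last 2 first.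
- exact: normc_ge0.
- by move=> j _; exact: normc_ge0.
rewrite sum_demean.
have -> : (L%:R)^-1 = ((L%:R)^-1 : R)%:C by rewrite rmorphV ?unitfE ?gt_eqF // rmorph_nat.
rewrite normcM normc_real ?invr_ge0 ?(ltW L0) // ler_pM2l ?invr_gt0 //.
apply: le_trans (le_sum_normc _ _) _; apply: ler_sum => j _.
by rewrite /f natrD mulrDl.
Qed.

(** Each term is at most a mean over its window. After exchanging the sums, every grid point is
    counted at most [K] times, and Parseval applies. *)
Lemma large_sieve_grid (I : eqType) (P : seq I) (c : I -> nat) (K : R) a :
  {in P, forall i, (c i <= 8 * N * L)%N} ->
  (forall t, (count (fun i => c i <= t < c i + L)%N P)%:R <= K) ->
  \sum_(i <- P) normc (\sum_(1 <= n < N.+1) a n * expc (n%:R * ((c i)%:R / M))) ^+ 2 <=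
  64 * K * N%:R * \sum_(1 <= n < N.+1) normc (a n) ^+ 2.
Proof.
move=> cM ubK; have L0 : 0 < L%:R :> R by rewrite ltr0n.
have K0 : 0 <= K by apply: le_trans (ubK 0); rewrite ler0n.
pose f t := normc (\sum_(1 <= n < N.+1) demean a n * expc (n%:R * (t%:R / M))) ^+ 2.
apply: le_trans (_ : \sum_(i <- P) L%:R^-1 * \sum_(j < L) f (c i + j)%N <= _).
  by apply: ler_sum => i _; exact: sqr_normc_sum_demean.
have window i : i \in P -> \sum_(j < L) f (c i + j)%N =
    \sum_(t < 2 * (8 * N * L)) (if (c i <= t < c i + L)%N then f t else 0).
  move=> /cM ciM; rewrite -(big_mkord xpredT (fun j => f (c i + j)%N)).
  rewrite -(big_mkord xpredT (fun t => if (c i <= t < c i + L)%N then f t else 0)).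
  have -> : \sum_(0 <= j < L) f (c i + j)%N = \sum_(c i <= t < c i + L) f t.
    rewrite -{2}[c i]add0n big_addn addKn; apply: eq_bigr => j _.
    by rewrite addnC.
  rewrite -big_mkcond /= (big_nat_widenl _ 0) // (big_nat_widen _ _ (2 * (8 * N * L))).
    by apply: eq_bigl => t; rewrite andTb.
  by move: ciM N_gt0 L_gt0; clear; nia.
under eq_big_seq => i iP do rewrite window //.
rewrite -mulr_sumr exchange_big /=.
apply: le_trans (_ : L%:R^-1 * \sum_(t < 2 * (8 * N * L)) K * f t <= _).
  rewrite ler_pM2l ?invr_gt0 //; apply: ler_sum => t _.
  rewrite -big_mkcond /= big_const_seq iter_addr addr0 -[leLHS]mulr_natl.
  by rewrite ler_wpM2r ?sqr_ge0.
rewrite -mulr_sumr parseval_grid.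
apply: le_trans (_ : L%:R^-1 * (K * (2 * M * \sum_(1 <= n < N.+1) 4 * normc (a n) ^+ 2)) <= _).
  rewrite !ler_wpM2l ?invr_ge0 ?mulr_ge0 ?ler0n ?(ltW M_gt0) // ler_sum_nat // => n /andP[_ nN].
  exact: sqr_normc_demean.
(* 64 = 2 * 8 * 4: two periods, the 8 in [M], and the loss from [demean]. *)
rewrite -mulr_sumr /M !natrM le_eqVlt; apply/orP; left; apply/eqP.
by field; rewrite gt_eqF.
Qed.

End Demean.
End GridSieve.


(** * Counting fractions b/q^2 in a window, and the sieve for natural [N] and [Q] *)

Section SquareModuli.
Import ComplexField.Normc.
Variables (R : realType) (N Q : nat) (D : R).
Hypotheses (N_gt0 : (0 < N)%N) (D_ge1 : 1 <= D).
Hypothesis le_D : forall n : nat, (0 < n <= N)%N -> (size (divisors n))%:R <= D.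

Lemma size_clustered_le (W : seq (nat * nat)) :
  uniq W -> clustered (8 * N) W -> {in W, forall w, (0 < w.1 <= Q)%N} ->
  {in W, forall w, coprime w.2 w.1} ->
  (size W)%:R <= 3 * D * (Q%:R ^+ 3 / N%:R + 1 + Q%:R ^+ 2 / Num.sqrt N%:R).
Proof.
move=> uW clW rW cW; have N0 : 0 < N%:R :> R by rewrite ltr0n.
have h0 : (0 < 8 * N)%N by rewrite muln_gt0.
have u0 : 0 <= Q%:R ^+ 3 / N%:R :> R by rewrite divr_ge0 ?exprn_ge0.
set y := Q%:R ^+ 2 / Num.sqrt N%:R.
have y0 : 0 <= y by rewrite divr_ge0 ?exprn_ge0 ?sqrtr_ge0.
(* For N < Q^2 the trivial count is already O(Q^3/N); otherwise each n <= Q^2 is at most N, where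
   [le_D] applies. *)
have [lt_QN|le_QN] := ltnP N (Q ^ 2).
  have kN : (size W * N <= 2 * Q ^ 3)%N.
    have := size_clustered h0 uW clW rW.
    have := leq_divM (Q ^ 2) (8 * N).
    rewrite (expnS Q 2); move: (Q ^ 2 %/ (8 * N))%N (size W) (Q ^ 2)%N lt_QN => e k s lt_QN le_e le_k.
    apply: leq_trans (leq_mul le_k (leqnn N)) _.
    rewrite mulnCA -mulnA leq_mul2l; apply/orP; right.
    by move: le_e lt_QN; clear; nia.
  have : (size W)%:R <= 2 * (Q%:R ^+ 3 / N%:R) :> R.
    by rewrite mulrA ler_pdivlMr // -natrM -natrX -natrM ler_nat.
  by move: D_ge1 u0 y0; move: (_ / N%:R) y => u y; nra.
have [d d_le eq_d] : exists2 d : nat, d%:R <= D & forall n, (0 < n <= Q ^ 2)%N -> (size (divisors n) <= d)%N.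
  exists (Num.truncn D); first by rewrite truncn_le // (le_trans ler01).
  move=> n /andP[n0 nQ]; rewrite truncn_ge_nat ?(le_trans ler01) //.
  by apply: le_D; rewrite n0 (leq_trans nQ).
have := size_clustered_coprime h0 (leq_trans le_QN (leq_pmull N (isT : 0 < 8)%N)) uW clW rW cW eq_d.
set E := (_ %/ _)%N; set k := size W => le_k.
have yE : E%:R * 4 <= y ^+ 2.
  rewrite /y expr_div_n sqr_sqrtr ?ler0n // -exprM ler_pdivlMr //.
  have := leq_divM (2 * Q ^ 4) (8 * N); rewrite -/E -natrX -!natrM ler_nat.
  by rewrite (_ : (2 * 2)%N = 4%N) //; clear; lia.
have {}le_k : k%:R * (k%:R - 1) <= 2 * (D * (2 * E%:R + 1)) :> R.
  case: k le_k => [|k] le_k; first by rewrite mul0r mulr_ge0 ?mulr_ge0 ?addr_ge0 // (le_trans ler01).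
  apply: le_trans (_ : (k.+1 * k)%:R <= _); first by rewrite natrM -natr1 addrK.
  apply: le_trans (_ : (2 * (d * (2 * E).+1))%:R <= _); first by rewrite ler_nat.
  by rewrite !natrM -[(2 * E).+1%:R]natr1 natrM ler_pM2l // ler_wpM2r // addr_ge0 ?mulr_ge0.
(* If k > D (3 + y), then k - 1 > D (2 + y) as D >= 1, so k (k - 1) > D (y^2 + 2) >= 2 D (2E + 1),
   against [le_k]. *)
apply: le_trans (_ : D * (3 + y) <= _).
  rewrite leNgt; apply/negP => lt_k.
  have : (D * (3 + y)) * (D * (2 + y)) < k%:R * (k%:R - 1).
    have Dy z : 0 <= z -> 0 <= D * (z + y).
      by move=> z0; rewrite mulr_ge0 ?addr_ge0 // (le_trans ler01).
    apply: ltr_pM; rewrite ?Dy //.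
    by move: lt_k D_ge1; rewrite !mulrDr; lra.
  have : D * (y ^+ 2 + 2) <= D * (3 + y) * (D * (2 + y)).
    rewrite -mulrA ler_pM2l ?(lt_le_trans ltr01) //.
    apply: le_trans (_ : (3 + y) * (2 + y) <= _); first by nra.
    by rewrite ler_wpM2l ?addr_ge0 // ler_peMl ?addr_ge0.
  have : 2 * (D * (2 * E%:R + 1)) <= D * (y ^+ 2 + 2).
    by rewrite mulrCA ler_pM2l ?(lt_le_trans ltr01) //; lra.
  by lra.
rewrite -mulrA mulrCA ler_pM2l ?(lt_le_trans ltr01) //.
by lra.
Qed.

Lemma square_sieve_nat (a : nat -> R[i]) :
  \sum_(1 <= q < Q.+1) \sum_(1 <= b < (q ^ 2).+1 | coprime b q)
    normc (\sum_(1 <= n < N.+1) a n * expc (n%:R * (b%:R / (q ^ 2)%:R))) ^+ 2 <=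
  192 * D * (Q%:R ^+ 3 + N%:R + Num.sqrt N%:R * Q%:R ^+ 2) *
    \sum_(1 <= n < N.+1) normc (a n) ^+ 2.
Proof.
have N0 : 0 < N%:R :> R by rewrite ltr0n.
(* Every q^2 with 0 < q <= Q divides [L], so the grid of step 1/M contains every b/q^2, at the index
   [c (q, b)]. *)
set L := (Q`! ^ 2)%N.
have L0 : (0 < L)%N by rewrite expn_gt0 fact_gt0.
set M := (8 * N * L)%N.
have M0 : (0 < M)%N by rewrite 2!muln_gt0 N_gt0 L0.
pose P := [seq (q, b) | q <- index_iota 1 Q.+1,
                        b <- [seq b <- index_iota 1 (q ^ 2).+1 | coprime b q]].
pose c (w : nat * nat) := (w.2 * (M %/ w.1 ^ 2))%N.
have uP : uniq P.
  apply: allpairs_uniq_dep => [|q _|]; rewrite ?filter_uniq ?iota_uniq //.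
  by move=> [q b] [q' b'] _ _ /= [-> ->].
have PE w : w \in P -> [/\ (0 < w.1 <= Q)%N, coprime w.2 w.1 & (w.2 <= w.1 ^ 2)%N].
  move=> /allpairsPdep[q [b [qP]]]; rewrite mem_filter => /andP[cop bP] ->.
  by move: qP bP; rewrite !mem_index_iota /= !ltnS => -> /andP[_ ->].
have cE w : w \in P -> (c w * w.1 ^ 2 = w.2 * M)%N.
  move=> /PE[/andP[q0 qQ] _ _]; rewrite /c -mulnA divnK //.
  by rewrite /M dvdn_mull // dvdn_exp2r // dvdn_fact // q0.
have cM w : w \in P -> (c w <= M)%N.
  move=> wP; have [/andP[q0 _] _ bq] := PE w wP.
  have q20 : (0 < w.1 ^ 2)%N by rewrite expn_gt0 q0.
  by rewrite -(leq_pmul2r q20) cE // mulnC leq_mul2l bq orbT.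
set K := 3 * D * (Q%:R ^+ 3 / N%:R + 1 + Q%:R ^+ 2 / Num.sqrt N%:R).
(* Windows sharing the point [t] start less than [L] grid steps apart, so their fractions differ by
   less than L/M = 1/(8N): this is [clustered (8 * N)]. *)
have count_le t : (count (fun w => c w <= t < c w + L)%N P)%:R <= K.
  rewrite -size_filter; apply: size_clustered_le.
  - by rewrite filter_uniq.
  - move=> w w'; rewrite !mem_filter => /andP[/andP[w1 w2] wP] /andP[/andP[w'1 w'2] w'P].
    have [/andP[q0 _] _ _] := PE w wP; have [/andP[q'0 _] _ _] := PE w' w'P.
    have lt_c : (c w < c w' + L)%N by apply: leq_ltn_trans w1 w'2.
    have ss : (0 < w.1 ^ 2 * w'.1 ^ 2)%N by rewrite muln_gt0 !expn_gt0 q0 q'0.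
    have := cE w wP; have := cE w' w'P; move: lt_c ss; rewrite /M.
    move: (w.1 ^ 2)%N (w'.1 ^ 2)%N (c w) (c w') w.2 w'.2 => s s' e e' b b' lt_c ss E' E.
    rewrite -(ltn_pmul2r ss) in lt_c.
    have H1 : (e * (s * s') = (b * (8 * N * L)) * s')%N by rewrite mulnA E.
    have H2 : (e' * (s * s') = (b' * (8 * N * L)) * s)%N by rewrite mulnCA E' mulnC.
    move: lt_c; rewrite mulnDl H1 H2.
    rewrite (_ : b * (8 * N * L) * s' = L * (8 * N * (b * s')))%N; last by ring.
    rewrite (_ : b' * (8 * N * L) * s + _ = L * (8 * N * (b' * s) + s * s'))%N; last by ring.
    by rewrite ltn_pmul2l.
  - by move=> w; rewrite mem_filter => /andP[_ /PE[]].
  - by move=> w; rewrite mem_filter => /andP[_ /PE[]].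
have := large_sieve_grid N_gt0 L0 a cM count_le.
have -> : \sum_(w <- P) normc (\sum_(1 <= n < N.+1) a n * expc (n%:R * ((c w)%:R / M%:R))) ^+ 2 =
  \sum_(w <- P) normc (\sum_(1 <= n < N.+1) a n * expc (n%:R * (w.2%:R / (w.1 ^ 2)%:R))) ^+ 2 :> R.
  apply: eq_big_seq => w wP; congr (normc _ ^+ 2); apply: eq_bigr => n _; congr (_ * expc (_ * _)).
  have [/andP[q0 _] _ _] := PE w wP.
  apply/eqP; rewrite eqr_div ?pnatr_eq0 -?lt0n ?expn_gt0 ?q0 //.
  by rewrite -!natrM cE.
rewrite big_allpairs_dep /=; under eq_bigr => q _ do rewrite big_filter.
move=> /le_trans; apply; rewrite le_eqVlt; apply/orP; left; apply/eqP; congr (_ * _).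
(* 192 = 64 * 3, and [N] times the bracket in [K] is Q^3 + N + sqrt(N) Q^2. *)
rewrite /K; set r := Num.sqrt N%:R.
have r0 : r != 0 by rewrite gt_eqF // sqrtr_gt0.
have -> : N%:R = r ^+ 2 by rewrite sqr_sqrtr ?ltW.
by field.
Qed.

End SquareModuli.

(** * Passage to real [Q] and [N] *)

Theorem theorem3 (R : realType) (eps : R) (eps_gt0 : 0 < eps) :
  exists C : R, 0 < C /\
    forall (Q N : R) (a : nat -> complex R), 1 <= Q -> 1 <= N ->
      square_sieve_sum Q N a <=
        C * ln (2 * Q) * N `^ eps *
          (Q ^+ 3 + N + N `^ (1 / 2) * Q ^+ 2) * coef_energy N a.
Proof.
have [C C1 HC] := divisor_bound eps_gt0.
have C0 : 0 < C := lt_le_trans ltr01 C1.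
have ln2 : 0 < ln 2 :> R by rewrite ln_gt0 // ltr1n.
(* Since Q >= 1, the factor ln(2Q) / ln 2 is at least 1 and can be inserted into the bound for the
   truncations. *)
exists (192 * C / ln 2); split; first by rewrite divr_gt0 // mulr_gt0.
move=> Q N a Q1 N1.
have Q0 : 0 <= Q := le_trans ler01 Q1; have N0 : 0 <= N := le_trans ler01 N1.
have Nn0 : (0 < Num.truncn N)%N by rewrite truncn_gt0.
have Neps : 1 <= N `^ eps by rewrite -(powRr0 N) ler_powR // ltW.
have leN : (Num.truncn N)%:R <= N by rewrite truncn_le.
have leQ : (Num.truncn Q)%:R <= Q by rewrite truncn_le.
have D1 : 1 <= C * N `^ eps by rewrite -[1]mulr1 ler_pM.
have le_D n : (0 < n <= Num.truncn N)%N -> (size (divisors n))%:R <= C * N `^ eps.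
  move=> /andP[n0 nN]; apply: le_trans (HC n n0) _; rewrite ler_pM2l //.
  by rewrite ge0_ler_powR ?nnegrE ?(ltW eps_gt0) // (le_trans _ leN) // ler_nat.
rewrite /square_sieve_sum /expsum /coef_energy.
apply: le_trans (square_sieve_nat (Num.truncn Q) Nn0 D1 le_D a) _.
rewrite ler_wpM2r ?sumr_ge0 // => [n _|]; first exact: sqr_ge0.
rewrite [leRHS](_ : _ = 192 * (C * N `^ eps) * (ln (2 * Q) / ln 2 *
   (Q ^+ 3 + N + N `^ (1 / 2) * Q ^+ 2))); last by field; rewrite gt_eqF.
rewrite ler_pM2l; last by rewrite mulr_gt0 ?(lt_le_trans ltr01 D1).
have l1 : 1 <= ln (2 * Q) / ln 2.
  by rewrite ler_pdivlMr // mul1r ler_ln ?posrE ?mulr_gt0 ?(lt_le_trans ltr01 Q1) //; lra.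
rewrite -[leLHS]mul1r ler_pM ?addr_ge0 ?mulr_ge0 ?exprn_ge0 ?sqrtr_ge0 ?ler0n //.
have leQk k : (Num.truncn Q)%:R ^+ k <= Q ^+ k by rewrite lerXn2r ?nnegrE.
apply: lerD; first by apply: lerD.
by rewrite mul1r powR12_sqrt // ler_pM ?sqrtr_ge0 ?exprn_ge0 // ler_wsqrtr.
Qed.
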